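(* Let $q$ be a power of an odd prime. Let $a_1\in\mathbb{F}_{q^4}^*$ be such that $a_1^{q^2+1}$ is a square of an element of $\mathbb{F}_q^*$, and let $\tilde a_0\in\mathbb{F}_{q^4}$ satisfy $\mathrm{Tr}_{q^4/q}(\tilde a_0)=-1$. Define $x*y=xy+\mathrm{Tr}_{q^4/q}(a_1xy^{q^2}+\tilde a_0xy)$ on $\mathbb{F}_{q^4}$. Then the presemifield $(\mathbb{F}_{q^4},+,* )$ is isotopic to a Dickson semifield.
   Context: $\mathrm{Tr}_{q^4/q}$ is the trace from $\mathbb{F}_{q^4}$ to $\mathbb{F}_q$. A presemifield is a finite set with operations $+,*$ such that $(\mathbb{S},+)$ is a group, both distributive laws hold, and $x*y=0$ implies $x=0$ or $y=0$. Two presemifields $(\mathbb{S}_1,+,* )$, $(\mathbb{S}_2,+,\star)$ are isotopic if there are additive bijections $L,M,N:\mathbb{S}_1\to\mathbb{S}_2$ with $M(x)\star N(y)=L(x*y)$ for all $x,y$. A Dickson (commutative) semifield of order $q^4$ is $\mathbb{F}_{q^2}\times\mathbb{F}_{q^2}$ with componentwise addition and multiplication $(a,b)\cdot(c,d)=(ac+j\,\sigma(b)\sigma(d),\ ad+bc)$, where $j$ is a nonsquare in $\mathbb{F}_{q^2}$ and $\sigma$ is a nontrivial field automorphism of $\mathbb{F}_{q^2}$. *)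

(* Defs.v *)
From HB Require Import structures.
From mathcomp Require Import all_boot all_order all_fingroup all_algebra all_solvable all_field.

Set Implicit Arguments.
Unset Strict Implicit.
Unset Printing Implicit Defensive.

Import GRing.Theory.
Local Open Scope ring_scope.

Definition presemifield (S : finZmodType) (mul : S -> S -> S) : Prop :=
  [/\ left_distributive mul +%R, right_distributive mul +%R
    & forall x y, mul x y = 0 -> x = 0 \/ y = 0].

Definition isotopic (S1 S2 : finZmodType)
    (mul1 : S1 -> S1 -> S1) (mul2 : S2 -> S2 -> S2) : Prop :=
  exists L M N : {additive S1 -> S2},
    [/\ bijective L, bijective M, bijective N
      & forall x y, mul2 (M x) (N y) = L (mul1 x y)].

HB.instance Definition _ (U V : finZmodType) := GRing.Zmodule.on (U * V)%type.

Definition nonsquare (E : finFieldType) (j : E) : Prop :=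
  ~ exists x : E, j = x ^+ 2.

Definition dickson_mul (E : finFieldType) (j : E) (sigma : {rmorphism E -> E})
    (u v : E * E) : E * E :=
  (u.1 * v.1 + j * sigma u.2 * sigma v.2, u.1 * v.2 + u.2 * v.1).

Definition isotopic_to_Dickson (q : nat) (S : finZmodType)
    (mul : S -> S -> S) : Prop :=
  exists (E : finFieldType) (j : E) (sigma : {rmorphism E -> E}),
    [/\ #|E| = (q ^ 2)%N, nonsquare j, bijective sigma, ~ (sigma =1 id)
      & isotopic mul (dickson_mul j sigma)].

(* [finvect_type L] is [L] with the finite field structure induced by that of
   [K], and, being a finite extension of a finite field, the splitting field
   structure that [galTrace] requires. [1] below is the subfield [K] of [L]. *)
Definition fieldTrace (K : finFieldType) (L : fieldExtType K)
    (x : finvect_type L) : finvect_type L :=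
  galTrace 1%AS {:finvect_type L}%AS x.

Definition star_mul (K : finFieldType) (L : fieldExtType K)
    (a1 a0 x y : finvect_type L) : finvect_type L :=
  x * y + fieldTrace (a1 * x * y ^+ (#|K| ^ 2)%N + a0 * x * y).

(* Main.v *)
Require Import Defs.
From HB Require Import structures.
From mathcomp Require Import all_boot all_order all_fingroup all_algebra all_solvable all_field.
From mathcomp Require Import ring.

Set Implicit Arguments.
Unset Strict Implicit.
Unset Printing Implicit Defensive.

Import GRing.Theory.
Local Open Scope ring_scope.

(* Write f for the q-th power map of F = F_{q^4}. If x * y = 0 with x, y nonzero,
   then t = xy is in F_q, and since Tr(a0 t) = - t we get Tr(z) = 0 for
   z = a1 y^{q^2-1}, whose norm over F_{q^2} is b^2; this is impossible.
   By Hilbert 90, replacing (x, y) by (c x, c^-1 y) reduces to a1 = b in F_q.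
   Let e^{q^2} = - e with e nonzero, so that F = E + E e with E = F_{q^2}. For
   X = r + s e and Y = u + v e, put W = (ru - (e^2 s v)^q) + (rv + su) e, which
   is the Dickson product with j = - (e^2)^q and sigma = f. Then XY - W lies in
   F_q, on which t + Tr(a0 t) vanishes, and Tr(X Y^{q^2}) = Tr(W); hence
   X * Y = W * 1, and W |-> W * 1 is bijective by the absence of zero divisors. *)

(** * Isotopy and fixed points of power maps *)

Lemma isotopic_sym (S1 S2 : finZmodType)
    (mul1 : S1 -> S1 -> S1) (mul2 : S2 -> S2 -> S2) :
  isotopic mul1 mul2 -> isotopic mul2 mul1.
Proof.
move=> [l [m [n [lB mB nB lmn]]]].
have inv (g : {additive S1 -> S2}) (gB : bijective g) :
    exists2 h : {additive S2 -> S1}, cancel h g & bijective h.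
  have [h gK hK] := gB.
  pose hA := GRing.isZmodMorphism.Build S2 S1 h (can2_zmod_morphism gK hK).
  by exists (HB.pack_for {additive S2 -> S1} h hA) => //=; exists g.
have [l' lK l'B] := inv l lB; have [m' mK m'B] := inv m mB.
have [n' nK n'B] := inv n nB.
exists l', m', n'; split=> // x y.
by apply: (bij_inj lB); rewrite -lmn mK nK lK.
Qed.

(** Every element is a root of ['X^n - 'X], of degree [n]. With [n = q ^ 2] this shows that [f \o f]
    is nontrivial on the big field, with [n = q] that [sigma] is nontrivial on the subfield. *)
Lemma card_le_expf_fixed (F : finFieldType) (n : nat) :
  (1 < n)%N -> (forall x : F, x ^+ n = x) -> (#|F| <= n)%N.
Proof.
move=> n_gt1 xn; have szP : size ('X^n - 'X : {poly F}) = n.+1.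
  by rewrite size_polyDl ?size_polyXn // size_polyN size_polyX.
have P_neq0 : 'X^n - 'X != 0 :> {poly F} by rewrite -size_poly_eq0 szP.
rewrite cardE -ltnS -szP; apply: max_poly_roots (enum_uniq _) => //.
by apply/allP => x _; rewrite /root !hornerE xn subrr.
Qed.

(** * The subfield fixed by the square of an endomorphism *)

Section FixedField.

Variables (F : finFieldType) (f : {rmorphism F -> F}).

Definition fixed2_pred : {pred F} := [pred x | f (f x) == x].

Fact fixed2_divring_closed : divring_closed fixed2_pred.
Proof.
split=> [|x y|x y]; rewrite !inE ?rmorph1 //.
  by move=> /eqP fx /eqP fy; rewrite !rmorphB /= fx fy.
by move=> /eqP fx /eqP fy; rewrite !fmorph_div /= fx fy.
Qed.
HB.instance Definition _ :=
  GRing.isDivringClosed.Build F fixed2_pred fixed2_divring_closed.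

(* The elements fixed by f \o f, i.e. F_{q^2} when f is the Frobenius of F_{q^4}. *)
Record fixed2 := Fixed2 { fixed2_val : F; _ : fixed2_val \in fixed2_pred }.

HB.instance Definition _ := [isSub for fixed2_val].
HB.instance Definition _ := [Finite of fixed2 by <:].
HB.instance Definition _ := [SubChoice_isSubIntegralDomain of fixed2 by <:].
HB.instance Definition _ := [SubIntegralDomain_isSubField of fixed2 by <:].

Lemma fixed2P (x : fixed2) : f (f (fixed2_val x)) = fixed2_val x.
Proof. by case: x => x /= /eqP. Qed.

Definition fixed2_frob (x : fixed2) : fixed2 :=
  Fixed2 (introT eqP (congr1 f (fixed2P x)) : f (fixed2_val x) \in fixed2_pred).

Fact fixed2_frob_zmod_morphism : zmod_morphism fixed2_frob.
Proof. by move=> x y; apply/val_inj; rewrite /= rmorphB. Qed.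
HB.instance Definition _ :=
  GRing.isZmodMorphism.Build fixed2 fixed2 fixed2_frob fixed2_frob_zmod_morphism.

Fact fixed2_frob_monoid_morphism : monoid_morphism fixed2_frob.
Proof. by split=> [|x y]; apply/val_inj; rewrite /= ?rmorph1 ?rmorphM. Qed.
HB.instance Definition _ :=
  GRing.isMonoidMorphism.Build fixed2 fixed2 fixed2_frob
    fixed2_frob_monoid_morphism.

Lemma fixed2_frob_bij : bijective fixed2_frob.
Proof.
by exists fixed2_frob => x; apply/val_inj; rewrite /= fixed2P.
Qed.

End FixedField.

(** * Absence of zero divisors *)

Section StarProduct.

Variables (F : finFieldType) (f : {rmorphism F -> F}).
Hypothesis f4 : forall x, f (f (f (f x))) = x.
Hypothesis two_neq0 : 2 != 0 :> F.

Definition tr4 (x : F) : F := x + f x + f (f x) + f (f (f x)).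

Lemma tr4_fixed x : f (tr4 x) = tr4 x.
Proof. by rewrite /tr4 !rmorphD /= f4; ring. Qed.

Lemma tr4D x y : tr4 (x + y) = tr4 x + tr4 y.
Proof. by rewrite /tr4 !rmorphD /=; ring. Qed.

Lemma tr4Z c x : f c = c -> tr4 (c * x) = c * tr4 x.
Proof. by move=> fc; rewrite /tr4 !rmorphM /= !fc; ring. Qed.

Lemma eq_opp0 (x : F) : x = - x -> x = 0.
Proof.
move=> /eqP; rewrite -addr_eq0 -mulr2n -mulr_natl mulf_eq0 (negPf two_neq0).
by move/eqP.
Qed.

Variables (a1 a0 b : F).
Hypothesis b_neq0 : b != 0.
Hypothesis b_fixed : f b = b.
Hypothesis a1_norm : a1 * f (f a1) = b ^+ 2.
Hypothesis a0_trace : tr4 a0 = -1.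

Definition star4 (x y : F) : F := x * y + tr4 (a1 * x * f (f y) + a0 * x * y).

(* If the trace vanishes then f z = - z or z * f z = - b ^+ 2; either way z is
   fixed by f \o f, so z = b or z = - b, which is absurd in odd characteristic. *)
Lemma tr4_neq0 (z : F) : z * f (f z) = b ^+ 2 -> tr4 z != 0.
Proof.
move=> zN; have fzN : f z * f (f (f z)) = b ^+ 2.
  by rewrite -rmorphM zN rmorphXn /= b_fixed.
have fix2 : f (f z) = z -> z = b \/ z = - b.
  move=> ffz; move: zN; rewrite ffz -expr2 => /eqP.
  by rewrite eqf_sqr => /orP[] /eqP; [left | right].
have bN : b = - b -> False by move=> /eq_opp0 /eqP; apply/negP.
apply/eqP => tz0.
(* Since [f (f z) = b ^+ 2 / z] and [f (f (f z)) = b ^+ 2 / f z], multiplying the trace by [z * f z]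
   clears the denominators, and the result factors. *)
have /eqP : (z + f z) * (z * f z + b ^+ 2) = 0.
  have -> : (z + f z) * (z * f z + b ^+ 2)
      = z * f z * tr4 z + z * (b ^+ 2 - f z * f (f (f z)))
        + f z * (b ^+ 2 - z * f (f z)) by rewrite /tr4; ring.
  by rewrite tz0 fzN zN; ring.
rewrite mulf_eq0 => /orP[|] /eqP zf.
  have fz : f z = - z by apply/eqP; rewrite -addr_eq0 addrC; apply/eqP.
  have /fix2[zb|zb] : f (f z) = z by rewrite fz rmorphN /= fz opprK.
    by apply: bN; rewrite -{1}b_fixed -zb fz.
  by apply: bN; rewrite -{2}b_fixed -rmorphN -zb fz zb opprK.
have zfz : z * f z = - b ^+ 2 by apply/eqP; rewrite -addr_eq0; apply/eqP.
have ffz : f (f z) = z.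
  have fz_neq0 : f z != 0.
    by apply: contraNneq b_neq0 => fz0; rewrite -sqrf_eq0 -fzN fz0 mul0r.
  apply: (mulfI fz_neq0); rewrite -rmorphM zfz rmorphN rmorphXn /= b_fixed.
  by rewrite mulrC zfz.
have b2N : b ^+ 2 = - b ^+ 2.
  by have [zb|zb] := fix2 ffz; rewrite -zfz zb ?rmorphN /= b_fixed; ring.
by move/eq_opp0/eqP: b2N; rewrite sqrf_eq0 (negPf b_neq0).
Qed.

Lemma star4_presemifield : presemifield star4.
Proof.
split=> [x y z|x y z|x y]; rewrite /star4 ?rmorphD /= -?tr4D.
- by rewrite addrACA -tr4D; congr (_ + tr4 _); ring.
- by rewrite addrACA -tr4D; congr (_ + tr4 _); ring.
move=> xy0; have [->|y_neq0] := eqVneq y 0; first by right.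
left; apply/eqP/negPn/negP => x_neq0.
have xyE : x * y = - tr4 (a1 * x * f (f y) + a0 * x * y).
  by apply/eqP; rewrite -addr_eq0 xy0.
have fxy : f (x * y) = x * y by rewrite xyE rmorphN /= tr4_fixed.
have xy_neq0 : x * y != 0 by rewrite mulf_neq0.
have ffy_neq0 : f (f y) != 0 by rewrite !fmorph_eq0.
have /eqP : x * y * tr4 (a1 * (f (f y) / y)) = 0.
  rewrite -[RHS]xy0 tr4D.
  have -> : a1 * x * f (f y) = x * y * (a1 * (f (f y) / y)) by field.
  have -> : a0 * x * y = x * y * a0 by ring.
  by rewrite !(tr4Z _ fxy) a0_trace; ring.
rewrite mulf_eq0 (negPf xy_neq0) /=; apply/negP/tr4_neq0.
(* The quotient [f (f y) / y] is inverted by [f \o f], so it does not change the norm of [a1]. *)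
rewrite -a1_norm !rmorphM !fmorphV /= f4; field.
by rewrite ffy_neq0.
Qed.

(** * The explicit isotopy *)

Hypothesis f2_nontrivial : exists t, f (f t) != t.

Lemma exists_f2_anti : exists2 e : F, e != 0 & f (f e) = - e.
Proof.
have [t tP] := f2_nontrivial; exists (t - f (f t)).
  by rewrite subr_eq0 eq_sym.
by rewrite !rmorphB /= f4 opprB.
Qed.

(* Hilbert 90 for the quadratic extension fixed by [f \o f]. *)
Lemma a1_normalise : exists2 c : F, c != 0 & a1 * c = b * f (f c).
Proof.
(* The general witness [b + f (f a1)] vanishes exactly when [a1 = - b]; in that case any nonzero
   element negated by [f \o f] serves. *)
have [a1b|a1b] := eqVneq (b + a1) 0.
  have [e e_neq0 fe] := exists_f2_anti; exists e => //.
  have -> : a1 = - b by apply/eqP; rewrite -addr_eq0 addrC a1b.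
  by rewrite fe; ring.
exists (b + f (f a1)).
  by rewrite -{1}b_fixed -{1}b_fixed -!rmorphD !fmorph_eq0.
rewrite !rmorphD /= f4 !b_fixed mulrDr a1_norm; ring.
Qed.

(** The inverse splits [x] into its components in the eigenspaces of [f \o f] for 1 and -1, the
    second one divided by [e]. *)
Lemma pair_emb_bij (e : F) : e != 0 -> f (f e) = - e ->
  bijective (fun u : fixed2 f * fixed2 f => fixed2_val u.1 + fixed2_val u.2 * e).
Proof.
move=> e_neq0 fe.
have r_fixed x : (x + f (f x)) / 2 \in fixed2_pred f.
  by rewrite inE !fmorph_div /= !rmorph_nat !rmorphD /= f4 [_ + x]addrC.
have s_fixed x : (x - f (f x)) / (2 * e) \in fixed2_pred f.
  rewrite inE !fmorph_div !rmorphB !rmorphM /= f4 fe !rmorph_nat; apply/eqP.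
  by field; rewrite oppr_eq0 e_neq0 two_neq0.
exists (fun x => (Fixed2 (r_fixed x), Fixed2 (s_fixed x))) => [[u v]|x] /=.
  congr (_, _); apply/val_inj => /=;
    rewrite !rmorphD !rmorphM /= fe !fixed2P; field; by rewrite ?e_neq0.
by field; rewrite e_neq0.
Qed.

Lemma card_fixed2 : (#|{: fixed2 f}| ^ 2)%N = #|F|.
Proof.
have [e e_neq0 fe] := exists_f2_anti.
by rewrite -(bij_eq_card (pair_emb_bij e_neq0 fe)) card_prod.
Qed.

Lemma star4_isotopic_dickson :
  exists j : fixed2 f, nonsquare j /\
    isotopic star4 (dickson_mul j (@fixed2_frob F f : {rmorphism _ -> _})).
Proof.
have [e e_neq0 fe] := exists_f2_anti; have [c c_neq0 cP] := a1_normalise.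
have j_fixed : - f (e * e) \in fixed2_pred f.
  by rewrite inE !rmorphN /= !rmorphM /= fe rmorphN /= mulrNN.
have fe_neq0 : f e != 0 by rewrite fmorph_eq0.
have ffc_neq0 : f (f c) != 0 by rewrite !fmorph_eq0.
exists (Fixed2 j_fixed); split.
  case=> x; rewrite (expr2 x) => /(congr1 val) /= jx.
  (* As [j] is [- (f e) ^+ 2], dividing a square root of it by [f e] gives a square root of -1. *)
  pose i := fixed2_val x / f e.
  (* f i = i or f i = - i, so f (f i) = i, whereas f (f e) = - e gives - i. *)
  have i2 : i ^+ 2 = -1.
    by rewrite /i expr_div_n [X in X / _]expr2 -jx rmorphM /=; field.
  have ffi : f (f i) = i.
    have : (f i) ^+ 2 == i ^+ 2 by rewrite -rmorphXn i2 rmorphN rmorph1.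
    by rewrite eqf_sqr => /orP[] /eqP fi; rewrite fi ?rmorphN /= fi ?opprK.
  have : i = - i.
    by rewrite -[LHS]ffi /i !fmorph_div /= fixed2P fe rmorphN /= invrN mulrN.
  by move/eq_opp0 => i0; move/eqP: i2; rewrite i0 expr0n eq_sym oppr_eq0 oner_eq0.
(* From the Dickson side, all three maps have explicit formulas in terms of [emb]. *)
apply: isotopic_sym.
pose emb (u : fixed2 f * fixed2 f) := fixed2_val u.1 + fixed2_val u.2 * e.
have embB : bijective emb := pair_emb_bij e_neq0 fe.
have emb_add : zmod_morphism emb by move=> u v; rewrite /emb /=; ring.
have scale_emb (d : F) : d != 0 ->
    exists2 m : {additive fixed2 f * fixed2 f -> F},
      m =1 (fun u => d * emb u) & bijective m.
  move=> d_neq0.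
  have mA : zmod_morphism (fun u => d * emb u).
    by move=> u v; rewrite emb_add mulrBr.
  pose mX := GRing.isZmodMorphism.Build _ _ (fun u => d * emb u) mA.
  exists (HB.pack_for {additive fixed2 f * fixed2 f -> F}
           (fun u => d * emb u) mX) => //=.
  apply: (@bij_comp _ _ _ ( *%R d) emb) => //.
  by exists ( *%R d^-1) => x; rewrite ?mulKf ?mulVKf.
have [m mE mB] := scale_emb c c_neq0.
have [n nE nB] := scale_emb c^-1 (invr_neq0 c_neq0).
have [starDl _ star_eq0] := star4_presemifield.
(* Here [c^-1] is the image under [n] of the Dickson identity (1, 0), which forces this form of
   [l]. *)
pose l u := star4 (m u) c^-1.
have lA : zmod_morphism l.
  move=> u v; rewrite /l raddfB; apply/eqP; rewrite eq_sym subr_eq -starDl.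
  by rewrite subrK.
have lB : bijective l.
  apply: inj_card_bij; last by rewrite (bij_eq_card mB).
  apply: (@raddf_inj _ _ (HB.pack_for {additive fixed2 f * fixed2 f -> F} l
           (GRing.isZmodMorphism.Build _ _ l lA))).
  move=> u /= /star_eq0 [mu0|/eqP]; last by rewrite invr_eq0 (negPf c_neq0).
  by apply: (bij_inj mB); rewrite mu0 raddf0.
exists (HB.pack_for {additive fixed2 f * fixed2 f -> F} l
         (GRing.isZmodMorphism.Build _ _ l lA)), m, n; split=> //= u v.
rewrite /l mE nE mE.
(* By the choice of [c], the rescaling turns the coefficient [a1] into [b], which leaves the trace
   because [f] fixes it. *)
have starE x y : star4 (c * x) (c^-1 * y)
    = x * y + b * tr4 (x * f (f y)) + tr4 (a0 * (x * y)).
  rewrite /star4 tr4D addrA -tr4Z //; congr (_ + tr4 _ + tr4 _).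
  - by field.
  - by rewrite !rmorphM /= !fmorphV [a1 * _]mulrA cP; field.
  - by field.
set W := emb (dickson_mul _ _ _ _); pose w := e * e * fixed2_val u.2 * fixed2_val v.2.
pose d := w + f w.
have ffw : f (f w) = w by rewrite /w !rmorphM /= fe !fixed2P mulrNN.
have fd : f d = d by rewrite /d rmorphD /= ffw addrC.
have WE : W = fixed2_val u.1 * fixed2_val v.1 - f w
    + (fixed2_val u.1 * fixed2_val v.2 + fixed2_val u.2 * fixed2_val v.1) * e.
  by rewrite /W /emb /w /= !rmorphM /=; ring.
have embM : emb u * emb v = W + d by rewrite WE /d /w /emb; ring.
(* Multiples of [e] by elements fixed by [f \o f] have trace 0, and on the remaining parts [w] and
   [f w] have the same trace. *)
have tr_emb : tr4 (emb u * f (f (emb v))) = tr4 W.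
  rewrite /tr4 WE /emb /w.
  by do 3![rewrite !(rmorphN, rmorphD, rmorphM) /= ?fixed2P ?fe]; ring.
(* Reading [c^-1] as [c^-1 * 1] lets [starE] apply to both sides. The surplus [d] then cancels
   against [tr4 (a0 * d) = - d]. *)
rewrite -[X in star4 (c * W) X]mulr1 !starE embM tr_emb !rmorph1 !mulr1.
by rewrite [a0 * (W + d)]mulrDr (tr4D (a0 * W)) [a0 * d]mulrC (tr4Z _ fd) a0_trace; ring.
Qed.

End StarProduct.

(** * The Galois trace as a sum of Frobenius iterates *)

Lemma big_cycle_ord (gT : finGroupType) (V : nmodType) (x : gT) (g : gT -> V) :
  \sum_(y in <[x]>%g) g y = \sum_(i < #[x]%g) g (x ^+ i)%g.
Proof.
have -> : <[x]>%g = [set (x ^+ i)%g | i : 'I_#[x]%g].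
  apply/setP => y; apply/idP/imsetP => [/cyclePmin[i lt_i ->]|[i _ ->]].
    by exists (Ordinal lt_i).
  exact: mem_cycle.
rewrite big_imset //= => i j _ _ /eqP; rewrite eq_expg_mod_order !modn_small //.
by move/eqP/val_inj.
Qed.

(** The Galois group over [K] is cyclic, generated by the Frobenius map, and its order is the degree
    4, so the trace runs over the four iterates of [f]. *)
Lemma finvect_frobenius (K : finFieldType) (L : fieldExtType K) :
  \dim {:L} = 4 -> exists2 f : {rmorphism finvect_type L -> finvect_type L},
    f =1 (fun x => x ^+ #|K|) & @fieldTrace K L =1 tr4 f.
Proof.
move=> dimL; pose F := finvect_type L.
have s1F : (1 <= {:F})%VS by apply: sub1v.
have [alpha /eqP galE alphaE] := finField_galois_generator s1F.
have ord_alpha : #[alpha]%g = 4.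
  by rewrite orderE -galE -galois_dim ?finField_galois // dimv1 divn1 dimL.
pose f : {rmorphism F -> F} := alpha.
have fE : f =1 (fun x => x ^+ #|K|).
  by move=> x; have := alphaE x (memvf x); rewrite dimv1 expn1.
exists f => // x.
rewrite /fieldTrace /galTrace galE big_cycle_ord ord_alpha.
have alphaX i : (alpha ^+ i)%g x = iter i f x.
  by elim: i => [|i IHi]; rewrite ?gal_id // expgSr galM ?memvf // IHi.
by rewrite !big_ord_recl big_ord0 addr0 /tr4 !alphaX /= !addrA.
Qed.

Theorem theorem3p6 (p k q : nat) (p_prime : prime p) (p_odd : odd p)
    (k_gt0 : (0 < k)%N) (q_def : q = (p ^ k)%N)
    (K : finFieldType) (cardK : #|K| = q)
    (L : fieldExtType K) (dimL : \dim {:L} = 4%N)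
    (a1 a0 : finvect_type L) (a1_neq0 : a1 != 0)
    (a1_norm : exists2 b : K, b != 0 & a1 ^+ (q ^ 2 + 1) = b%:A ^+ 2)
    (a0_trace : fieldTrace a0 = -1) :
  presemifield (star_mul a1 a0) /\ isotopic_to_Dickson q (star_mul a1 a0).
Proof.
have [f fE trE] := finvect_frobenius dimL.
have [b b_neq0 bE] := a1_norm.
pose F : finFieldType := finvect_type L.
have cardF : #|F| = (q ^ 4)%N.
  by rewrite -(card_vspacef (Vector.class F)) card_vspace cardK dimL.
have q_gt1 : (1 < q)%N by rewrite -cardK finNzRing_gt1.
have f2E x : f (f x) = x ^+ (q ^ 2) by rewrite !fE cardK -exprM.
have f4 x : f (f (f (f x))) = x.
  by rewrite !f2E -exprM -expnD -[X in _ ^+ X]cardF expf_card.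
have two_neq0 : 2 != 0 :> F.
  have pF : p \in [pchar F].
    by apply: (@card_finPcharP _ _ (k * 4)) => //; rewrite cardF q_def expnM.
  rewrite -(dvdn_pcharf pF); apply/negP => /dvdn_leq => /(_ isT).
  by case: (p) p_prime p_odd => [|[|[|]]].
pose B : F := b%:A.
have B_neq0 : B != 0 by rewrite scaler_eq0 oner_eq0 orbF.
have fB : f B = B.
  by rewrite fE /B -in_algE -rmorphXn expf_card.
have a1N : a1 * f (f a1) = B ^+ 2.
  by rewrite f2E -exprS -addn1 bE.
have a0T : tr4 f a0 = -1 by rewrite -trE.
have starE x y : star4 f a1 a0 x y = star_mul a1 a0 x y.
  by rewrite /star4 /star_mul trE f2E cardK.
have f2_nt : exists t, f (f t) != t.
  apply/existsP; apply: contraT; rewrite negb_exists => /forallP allF.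
  have := @card_le_expf_fixed F (q ^ 2); rewrite cardF leq_exp2l //.
  rewrite -{1}(exp1n 2) ltn_exp2r // => /(_ q_gt1); apply => x.
  by apply/eqP; rewrite -f2E -[_ == _]negbK allF.
have cardE : #|{: fixed2 f}| = (q ^ 2)%N.
  apply/eqP; rewrite -eqn_sqr; apply/eqP.
  by rewrite (card_fixed2 f4 two_neq0 f2_nt) cardF -expnM.
split.
  have [Dl Dr eq0] :=
    star4_presemifield f4 two_neq0 B_neq0 fB a1N a0T.
  by split=> [x y z|x y z|x y]; rewrite -!starE; [apply: Dl|apply: Dr|apply: eq0].
have [j [j_nsq [l [m [n [lB mB nB lmn]]]]]] :=
  star4_isotopic_dickson f4 two_neq0 B_neq0 fB a1N a0T f2_nt.
exists (fixed2 f), j, (@fixed2_frob _ f : {rmorphism _ -> _}); split=> //.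
- exact: fixed2_frob_bij.
- move=> sigma1; have : (q ^ 2 <= q)%N.
    rewrite -cardE; apply: card_le_expf_fixed => // x; apply: val_inj.
    by rewrite rmorphXn /= -cardK -fE -[in RHS](sigma1 x).
  by rewrite leqNgt -[X in (X < _)%N]expn1 ltn_exp2l.
- by exists l, m, n; split=> // x y; rewrite lmn starE.
Qed.
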